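(* For every uniformly induced Lubell-bounded poset $P$ other than $C_1$ or $C_2$ we have $$RR^{*}(P,A_3)=2+2e^*(P).$$
   Context: All posets are finite and non-empty. $B_n$ is the Boolean lattice of all subsets of $[n]=\{1,\dots,n\}$ ordered by inclusion; a level of $B_n$ is the collection of all sets of a given size. $C_l$ is the chain on $l$ elements and $A_k$ is the antichain on $k$ elements. A subset $X$ of a poset $R$ is a strong (induced) copy of a poset $P$ if there is a bijection $\alpha:P\to X$ such that $p\le_P p'$ if and only if $\alpha(p)\le_R\alpha(p')$. A copy is monochromatic with respect to a coloring if all its elements have the same color, and rainbow if its elements have pairwise distinct colors. The strong rainbow Ramsey number $RR^*(P,Q)$ is the minimum $n$ such that any coloring of $B_n$ (with colors from $\mathbb{N}$, any number of colors) admits either a monochromatic strong copy of $P$ or a rainbow strong copy of $Q$. A family $\mathcal{F}\subseteq B_n$ is induced $P$-free if it contains no strong copy of $P$. $e^*(P)$ is the maximum number $m$ such that for every $n$ the union of any $m$ consecutive levels of $B_n$ is induced $P$-free. The Lubell-mass of $\mathcal{F}\subseteq B_n$ is $\lambda_n(\mathcal{F})=\sum_{F\in\mathcal{F}}\binom{n}{|F|}^{-1}$, and $\lambda^*_n(P)$ is the maximum of $\lambda_n(\mathcal{F})$ over all induced $P$-free families $\mathcal{F}\subseteq B_n$. $P$ is uniformly induced Lubell-bounded if $e^*(P)\ge\lambda^*_n(P)$ for all positive integers $n$. *)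

(* Defs.v *)
From HB Require Import structures.
From mathcomp Require Import all_boot all_order all_algebra.
From mathcomp Require Import boolp.

Set Implicit Arguments.
Unset Strict Implicit.
Unset Printing Implicit Defensive.

(* Makes inclusion the canonical order of {set T}; the Boolean lattice B_n is
   then {set 'I_n}, and the chain C_l is 'I_l with its canonical order. *)
Export Order.DefaultSetSubsetOrder.
Import Order.Theory GRing.Theory Num.Theory.

Fact antichain_display : Order.disp_t. Proof. exact: Order.Disp tt tt. Qed.

Definition antichain (k : nat) : Type := 'I_k.
HB.instance Definition _ k := Finite.on (antichain k).

Fact antichain_anti k : antisymmetric (fun x y : antichain k => x == y).
Proof. by move=> x y /andP[/eqP]. Qed.

Fact antichain_trans k : transitive (fun x y : antichain k => x == y).
Proof. by move=> y x z /eqP ->. Qed.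

HB.instance Definition _ k :=
  Order.Le_isPOrder.Build antichain_display (antichain k)
    (@eqxx _) (@antichain_anti k) (@antichain_trans k).

Definition poset_iso d d' (P : finPOrderType d) (Q : finPOrderType d') : Prop :=
  exists2 f : P -> Q, bijective f & {mono f : p q / (p <= q)%O}.

(* All maps involved are finite, so this is a boolean predicate; a bijection
   from P onto X is an injection with image X. *)
Definition strong_copy d d' (P : finPOrderType d) (R : finPOrderType d')
    (X : {set R}) : bool :=
  [exists f : {ffun P -> R},
    [&& injectiveb f, f @: P == X &
        [forall p, forall q, (p <= q)%O == (f p <= f q)%O]]].

Definition induced_free d d' (P : finPOrderType d) (R : finPOrderType d')
    (F : {set R}) : bool :=
  ~~ [exists X : {set R}, (X \subset F) && strong_copy P X].

Definition monochromatic (R : finType) (c : R -> nat) (X : {set R}) : Prop :=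
  {in X &, forall x y, c x = c y}.

Definition rainbow (R : finType) (c : R -> nat) (X : {set R}) : Prop :=
  {in X &, injective c}.

Definition rainbow_ramsey_prop d d' (P : finPOrderType d)
    (Q : finPOrderType d') (n : nat) : Prop :=
  forall c : {set 'I_n} -> nat,
    (exists2 X : {set {set 'I_n}}, strong_copy P X & monochromatic c X) \/
    (exists2 X : {set {set 'I_n}}, strong_copy Q X & rainbow c X).

(* RR*(P, Q) = n; existence of the minimum is part of this assertion. *)
Definition strong_rainbow_ramsey_number d d' (P : finPOrderType d)
    (Q : finPOrderType d') (n : nat) : Prop :=
  rainbow_ramsey_prop P Q n /\
  forall m, rainbow_ramsey_prop P Q m -> (n <= m)%N.

(* The union of the levels k, k+1, ..., k+m-1 of B_n. *)
Definition consecutive_levels (n k m : nat) : {set {set 'I_n}} :=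
  [set F : {set 'I_n} | (k <= #|F| < k + m)%N].

(* B_n has n+1 levels, numbered 0 to n; the bound k + m <= n + 1 says that
   the m levels starting at k all exist. *)
Definition levels_induced_free d (P : finPOrderType d) (m : nat) : Prop :=
  forall n k, (k + m <= n.+1)%N -> induced_free P (consecutive_levels n k m).

Lemma ex_levels_induced_free d (P : finPOrderType d) :
  (0 < #|P|)%N -> exists m, `[< levels_induced_free P m >].
Proof.
case/card_gt0P=> p _; exists 0; apply/asboolP=> n k _.
apply/existsP=> -[X /andP[sXF /existsP[f /and3P[_ /eqP fX _]]]].
have /(subsetP sXF) : f p \in X by rewrite -fX imset_f.
by rewrite inE addn0 ltnNge => /andP[->].
Qed.

Lemma levels_induced_free_bound d (P : finPOrderType d) m :
  `[< levels_induced_free P m >] -> (m <= #|P|)%N.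
Proof.
move=> /asboolP free; rewrite leqNgt; apply/negP=> ltPm.
have m_gt0 : (0 < m)%N by apply: leq_trans ltPm.
have le_m : (0 + m <= m.-1.+1)%N by rewrite add0n prednK.
apply/negP: (free _ _ le_m); rewrite negbK.
have ord_p (p : P) : (enum_rank p < m.-1)%N.
  by apply: leq_trans (ltn_ord _) _; rewrite -ltnS (prednK m_gt0).
pose down p : {set 'I_m.-1} := [set Ordinal (ord_p q) | q : P & (q <= p)%O].
have memE p q : (Ordinal (ord_p q) \in down p) = (q <= p)%O.
  apply/imsetP/idP=> [[r] | le_qp]; last by exists q; rewrite ?inE.
  by rewrite inE => le_rp [/ord_inj/enum_rank_inj ->].
have mono p q : (p <= q)%O = (down p \subset down q).
  apply/idP/subsetP=> [le_pq i /imsetP[r] | sub_pq].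
    by rewrite inE => le_rp ->; rewrite memE (le_trans le_rp).
  by have := sub_pq (Ordinal (ord_p p)); rewrite !memE lexx => ->.
apply/existsP; exists [set down p | p in P]; apply/andP; split.
  apply/subsetP=> F _; rewrite inE add0n leq0n /=.
  by rewrite -[X in (_ < X)%N](prednK m_gt0) ltnS -[X in (_ <= X)%N]card_ord
    max_card.
apply/existsP; exists [ffun p => down p]; apply/and3P; split.
- apply/injectiveP=> p q; rewrite !ffunE => eq_pq.
  by apply/le_anti; rewrite !mono eq_pq subxx.
- by apply/eqP/eq_imset=> p; rewrite ffunE.
- by apply/'forall_forallP=> p q; rewrite !ffunE mono.
Qed.

Definition e_star d (P : finPOrderType d) (P_gt0 : (0 < #|P|)%N) : nat :=
  ex_maxn (ex_levels_induced_free P_gt0) (@levels_induced_free_bound d P).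

Lemma e_starP d (P : finPOrderType d) (P_gt0 : (0 < #|P|)%N) :
  levels_induced_free P (e_star P_gt0) /\
  forall m, levels_induced_free P m -> (m <= e_star P_gt0)%N.
Proof.
rewrite /e_star; case: ex_maxnP => m /asboolP free max; split=> // m' free'.
exact/max/asboolP.
Qed.

Local Open Scope ring_scope.

Definition lubell_mass (n : nat) (F : {set {set 'I_n}}) : rat :=
  \sum_(A in F) ('C(n, #|A|)%:R)^-1.

(* The default 0 does not affect the maximum: Lubell masses are nonnegative
   and the empty family is induced P-free for non-empty P. *)
Definition lambda_star d (P : finPOrderType d) (n : nat) : rat :=
  \big[Num.max/0]_(F : {set {set 'I_n}} | induced_free P F) lubell_mass F.

Definition uniformly_induced_lubell_bounded d (P : finPOrderType d)
    (P_gt0 : (0 < #|P|)%N) : Prop :=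
  forall n, (0 < n)%N -> lambda_star P n <= (e_star P_gt0)%:R.

(* Main.v *)
(* Lower bound: in B_(2e+1) colour e consecutive levels by 1, the next e levels
   by 2, and give the empty set and the full set colours of their own; the last
   two sets belong to no antichain of size 3.
   Upper bound: put n = 2e+2 and suppose that B_n has no rainbow A_3 and that
   every colour class has Lubell mass at most e = n/2 - 1 (as it does when it is
   induced P-free). Masses force a third colour besides any two, even away from
   the empty and the full set. If the levels 2, ..., n-2 are all monochromatic,
   then either one colour has mass n-3 > e, or two of these levels and a set of
   a third colour give a rainbow antichain. Otherwise some level j in this range
   carries exactly two colours a and b, and every set of a third colour is
   comparable to all a-sets or to all b-sets of level j. When both kinds of
   third-colour sets occur, they are {x} and its complement, level j is coloured
   by membership of x, and one colour contains nearly half of the cube. When, say,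
   all are comparable to the b-sets, there is a set S such that every set of size
   at least 2 incomparable to S has colour a, and the mass of a exceeds e.
   The hypothesis P <> C_1, C_2 gives e >= 2, as B_1 is then induced P-free. *)
Require Import Defs.
From mathcomp Require Import all_boot all_order all_algebra.
From mathcomp Require Import lra ring zify.
From mathcomp Require Import boolp.

Set Implicit Arguments.
Unset Strict Implicit.
Unset Printing Implicit Defensive.
Import Order.TTheory GRing.Theory Num.Theory.

Lemma exists_card_between (T : finType) (A B : {set T}) k :
  A \subset B -> #|A| <= k <= #|B| ->
  exists C : {set T}, [/\ A \subset C, C \subset B & #|C| = k].
Proof.
move=> sAB /andP[leAk lekB].
elim: k leAk lekB => [|k IHk].
  by rewrite leqn0 => /eqP A0 _; exists A.
rewrite leq_eqVlt => /orP[/eqP Ak _|]; first by exists A.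
rewrite ltnS => leAk ltkB.
have [C [sAC sCB Ck]] := IHk leAk (ltnW ltkB).
have /properP[_ [x xB xC]] : C \proper B.
  by rewrite properEcard sCB Ck.
exists (x |: C); split; last by rewrite cardsU1 xC Ck.
  exact: subset_trans sAC (subsetUr _ _).
by rewrite subUset sub1set xB.
Qed.

(** * Lubell mass: monotonicity, subadditivity, complements, levels *)

Section LubellMass.
Local Open Scope ring_scope.
Variable n : nat.
Implicit Types (F G : {set {set 'I_n}}) (S : {set 'I_n}).

Lemma invbin_ge0 k : 0 <= ('C(n, k)%:R)^-1 :> rat.
Proof. by rewrite invr_ge0 ler0n. Qed.

Lemma lubell_massS F G : F \subset G -> lubell_mass F <= lubell_mass G.
Proof.
move=> /setIidPr sFG; rewrite /lubell_mass [leRHS](big_setID F) /= sFG lerDl.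
by apply: sumr_ge0 => A _; apply: invbin_ge0.
Qed.

Lemma lubell_massU F G :
  lubell_mass (F :|: G) <= lubell_mass F + lubell_mass G.
Proof.
rewrite {1}/lubell_mass (big_setID F) /= setUK lerD2l.
rewrite setDUl setDv set0U; exact/lubell_massS/subsetDl.
Qed.

Lemma lubell_mass_setC F : lubell_mass [set ~: A | A in F] = lubell_mass F.
Proof.
rewrite /lubell_mass big_imset /=; last by move=> A B _ _ /setC_inj.
apply: eq_bigr => A _; rewrite [#|~: A|]cardsCs setCK card_ord bin_sub //.
by rewrite -[leqRHS]card_ord max_card.
Qed.

Lemma lubell_mass1 S : lubell_mass [set S] = ('C(n, #|S|)%:R)^-1.
Proof. exact: big_set1. Qed.

Lemma lubell_mass_level k : (k <= n)%N ->
  lubell_mass [set A : {set 'I_n} | #|A| == k] = 1.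
Proof.
move=> lekn; rewrite /lubell_mass.
rewrite (eq_bigr (fun=> ('C(n, k)%:R)^-1)) => [|A]; last first.
  by rewrite inE => /eqP ->.
rewrite sumr_const card_draws card_ord -[LHS]mulr_natl mulfV //.
by rewrite pnatr_eq0 -lt0n bin_gt0.
Qed.

End LubellMass.

(** * Lubell masses of principal ideals and filters *)

Section LubellMassValues.
Local Open Scope ring_scope.

(* Induction on s, since C(s+1,l+1)/C(n+1,l+1) = (s+1)/(n+1) C(s,l)/C(n,l). *)
Lemma sum_bin_ratio n s : (s <= n)%N ->
  \sum_(l < s.+1) 'C(s, l)%:R / 'C(n, l)%:R
    = n.+1%:R / (n - s).+1%:R :> rat.
Proof.
elim: s n => [|s IHs] n.
  by move=> _; rewrite big_ord1 !bin0 subn0 !divff // pnatr_eq0.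
case: n => // n; rewrite ltnS => lesn.
rewrite big_ord_recl !bin0 divr1 subSS.
under eq_bigr => l _.
  rewrite lift0.
  have -> : 'C(s.+1, l.+1)%:R / 'C(n.+1, l.+1)%:R
      = s.+1%:R / n.+1%:R * ('C(s, l)%:R / 'C(n, l)%:R) :> rat.
    have ltln : (l <= n)%N by rewrite (leq_trans _ lesn) // -ltnS.
    have /(congr1 (fun k => k%:R : rat)) := mul_bin_diag s.+1 l.
    have /(congr1 (fun k => k%:R : rat)) := mul_bin_diag n.+1 l.
    have nz : 'C(n, l)%:R != 0 :> rat by rewrite pnatr_eq0 -lt0n bin_gt0.
    have nz1 : 'C(n.+1, l.+1)%:R != 0 :> rat by rewrite pnatr_eq0 -lt0n bin_gt0.
    have nzn : n.+1%:R != 0 :> rat by rewrite pnatr_eq0.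
    have nzl : l.+1%:R != 0 :> rat by rewrite pnatr_eq0.
    rewrite !natrM /= => En Es; rewrite mulf_div; apply/eqP.
    rewrite eqr_div ?mulf_neq0 //; apply/eqP/(mulfI nzl).
    by rewrite [LHS]mulrA -Es En; ring.
  over.
rewrite -mulr_sumr IHs // mulf_div.
have nzn : n.+1%:R != 0 :> rat by rewrite pnatr_eq0.
have nzs : (n - s).+1%:R != 0 :> rat by rewrite pnatr_eq0.
rewrite [_%:R * _ / _](_ : _ = s.+1%:R / (n - s).+1%:R); last first.
  by field; rewrite !nat1r nzs nzn.
rewrite -[X in X + _](divff nzs) -mulrDl -natrD; congr (_%:R / _); lia.
Qed.

Lemma lubell_mass_powerset n (S : {set 'I_n}) :
  lubell_mass (powerset S) = n.+1%:R / (n - #|S|).+1%:R.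
Proof.
rewrite -sum_bin_ratio; last by rewrite -[leqRHS]card_ord max_card.
rewrite /lubell_mass.
rewrite (partition_big (fun A : {set 'I_n} => inord #|A| : 'I_#|S|.+1) predT) //=.
apply: eq_bigr => l _.
rewrite (eq_bigl [in [set A : {set 'I_n} | A \subset S & #|A| == l]]).
  rewrite (eq_bigr (fun=> ('C(n, l)%:R)^-1)) => [|A]; last first.
    by rewrite inE => /andP[_ /eqP ->].
  by rewrite sumr_const cards_draws -[LHS]mulr_natl.
move=> A; rewrite !inE; case sAS: (A \subset S) => //=.
by rewrite -val_eqE /= inordK // ltnS subset_leq_card.
Qed.

Lemma lubell_mass_supersets n (S : {set 'I_n}) :
  lubell_mass [set A : {set 'I_n} | S \subset A] = n.+1%:R / #|S|.+1%:R.
Proof.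
have -> : [set A : {set 'I_n} | S \subset A] = [set ~: A | A in powerset (~: S)].
  apply/setP=> A; rewrite inE; apply/idP/imsetP=> [sSA|[B]].
    by exists (~: A); rewrite ?setCK // inE setCS.
  by rewrite inE => sB ->; rewrite -setCS setCK.
rewrite lubell_mass_setC lubell_mass_powerset [#|~: S|]cardsCs setCK card_ord.
by rewrite subKn // -[leqRHS]card_ord max_card.
Qed.

Lemma lubell_massT n : lubell_mass [set: {set 'I_n}] = n.+1%:R.
Proof. by rewrite -powersetT lubell_mass_powerset cardsT card_ord subnn divr1. Qed.

End LubellMassValues.

(** * Incomparability of sets, and the colourings to be excluded *)

Section Incomparable.
Variable T : finType.
Implicit Types A B : {set T}.

Definition incomparable A B := ~~ (A \subset B) && ~~ (B \subset A).

Lemma incomparable_sym A B : incomparable A B = incomparable B A.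
Proof. exact: andbC. Qed.

Lemma incomparableI A B x y :
  x \in A -> x \notin B -> y \in B -> y \notin A -> incomparable A B.
Proof.
move=> xA xB yB yA; apply/andP; split; apply/subsetPn.
  by exists x.
by exists y.
Qed.

Lemma incomparable_card A B : #|A| = #|B| -> A != B -> incomparable A B.
Proof.
move=> eqAB neAB; apply/andP; split; apply: contra neAB => sub.
  by rewrite eqEcard sub eqAB leqnn.
by rewrite eq_sym eqEcard sub eqAB leqnn.
Qed.

Lemma comparable_leq_card A B :
  ~~ incomparable A B -> #|A| < #|B| -> A \subset B.
Proof.
rewrite negb_and !negbK => /orP[//|sBA].
by rewrite ltnNge subset_leq_card.
Qed.

Lemma incomparableC A B : incomparable (~: A) (~: B) = incomparable A B.
Proof. by rewrite /incomparable !setCS andbC. Qed.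

End Incomparable.

Definition color_class n (c : {set 'I_n} -> nat) a := [set X | c X == a].

Definition no_rainbow_antichain3 n (c : {set 'I_n} -> nat) :=
  forall X Y Z, incomparable X Y -> incomparable X Z -> incomparable Y Z ->
  c X != c Y -> c X != c Z -> c Y != c Z -> False.

(** What the absence of a monochromatic copy of [P] becomes: from here on [P] enters only through
    the bound [e]. *)
Definition light_classes n e (c : {set 'I_n} -> nat) :=
  forall a, (lubell_mass (color_class c a) <= e%:R)%R.

(** Complementation reverses inclusion but keeps incomparability. This duality settles the case of
    third-colour sets below [B0]. *)
Lemma no_rainbow_antichain3C n (c : {set 'I_n} -> nat) :
  no_rainbow_antichain3 c -> no_rainbow_antichain3 (fun X => c (~: X)).
Proof.
by move=> rf X Y Z XY XZ YZ; apply: rf; rewrite incomparableC.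
Qed.

Lemma light_classesC n e (c : {set 'I_n} -> nat) :
  light_classes e c -> light_classes e (fun X => c (~: X)).
Proof.
move=> light a; rewrite -lubell_mass_setC; apply: le_trans (light a).
apply/lubell_massS/subsetP=> X /imsetP[Y].
by rewrite !inE => cY ->.
Qed.

(* The summands bound the masses of a colour class, of the singletons outside an
   s-set S, of the subsets of S and of the supersets of S. *)
Lemma star_mass_lt n e s : n = 2 * e + 2 -> 1 < e -> 1 < s < n ->
  (e%:R + (n - s)%:R / n%:R + (n.+1%:R / (n - s).+1%:R + n.+1%:R / s.+1%:R)
    < n.+1%:R :> rat)%R.
Proof.
move=> nE e_gt1 /andP[s_gt1 s_ltn].
have e2 : (2 <= e%:R :> rat)%R by rewrite (ler_nat _ 2).
have nQ : (n%:R = 2 * e%:R + 2 :> rat)%R by rewrite nE natrD natrM.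
have n0 : (0 < n%:R :> rat)%R by rewrite nQ; lra.
have s2 : (2 <= s%:R :> rat)%R by rewrite (ler_nat _ 2).
rewrite -!natr1 natrB ?(ltnW s_ltn) //.
have [s_max|s_max] := eqVneq s.+1 n.
  have -> : (s%:R = n%:R - 1 :> rat)%R by rewrite -s_max -natr1; ring.
  have n6 : (n%:R^-1 <= 6%:R^-1 :> rat)%R.
    by rewrite lef_pV2 ?ler_nat ?posrE ?ltr0n; lia.
  have nn : (n%:R * n%:R^-1 = 1 :> rat)%R by rewrite mulfV // gt_eqF.
  rewrite subrK subKr !mulrDl nn.
  move: n6; move: (n%:R^-1)%R => t n6; by rewrite -(natrD _ 1 1) addn1 nQ; lra.
have s_le : (s%:R + 2 <= n%:R :> rat)%R by rewrite -natrD ler_nat; lia.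
have x0 : (0 < n%:R - s%:R + 1 :> rat)%R by lra.
have y0 : (0 < s%:R + 1 :> rat)%R by lra.
have lt1 : ((n%:R - s%:R) / n%:R < 1 :> rat)%R by rewrite ltr_pdivrMr //; lra.
suff : ((n%:R + 1) / (n%:R - s%:R + 1) + (n%:R + 1) / (s%:R + 1)
    <= n%:R - e%:R :> rat)%R by lra.
rewrite addf_div ?gt_eqF // ler_pdivrMr ?mulr_gt0 //.
(* The two fractions add up to [(n+1)(n+2)/((n-s+1)(s+1))], so this inequality bounds them by
   [(n+2)/2], which equals [n-e]. *)
have xy : (2 * (n%:R + 1) <= (n%:R - s%:R + 1) * (s%:R + 1) :> rat)%R.
  have : (0 <= (n%:R - s%:R - 2) * (s%:R - 2) :> rat)%R.
    by rewrite mulr_ge0 // subr_ge0 // lerBrDr addrC.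
  by rewrite nQ; lra.
have /ler_wpM2l/(_ _ _ xy) : (0 <= n%:R - e%:R :> rat)%R by lra.
apply: le_trans; rewrite -mulrDr.
by rewrite nQ; lra.
Qed.

(** * Sets of size [j] containing and avoiding given points *)

Section LevelSets.
Variable n : nat.

Lemma card_setC_ord (S : {set 'I_n}) : #|~: S| = n - #|S|.
Proof. by rewrite cardsCs setCK card_ord. Qed.

Lemma card_leq_ord (S : {set 'I_n}) : #|S| <= n.
Proof. by rewrite -[leqRHS]card_ord max_card. Qed.

Lemma exists_level_set j (P Q : {set 'I_n}) :
  [disjoint P & Q] -> #|P| <= j -> j + #|Q| <= n ->
  exists2 A : {set 'I_n}, #|A| = j & (P \subset A) && [disjoint A & Q].
Proof.
rewrite disjoints_subset => PQ leP leQ.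
have [|A [PA AQ Aj]] := @exists_card_between _ P (~: Q) j PQ.
  by rewrite leP card_setC_ord; lia.
by exists A => //; rewrite PA disjoints_subset.
Qed.

Lemma exists_level_set21 j (y z x : 'I_n) : 2 <= j -> j < n ->
  x != y -> x != z ->
  exists A : {set 'I_n}, [/\ #|A| = j, y \in A, z \in A & x \notin A].
Proof.
move=> j2 jn xy xz.
have [|||A Aj] := @exists_level_set j [set y; z] [set x].
- by rewrite disjoint_sym disjoints1 !inE negb_or xy.
- by rewrite cards2; case: (_ != _); lia.
- by rewrite cards1; lia.
by rewrite subUset !sub1set disjoint_sym disjoints1 => /andP[/andP[? ?] ?]; exists A.
Qed.

Lemma exists_level_set12 j (y x z : 'I_n) : 1 <= j -> j.+1 < n ->
  y != x -> y != z ->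
  exists A : {set 'I_n}, [/\ #|A| = j, y \in A, x \notin A & z \notin A].
Proof.
move=> j1 jn yx yz.
have [|||A Aj] := @exists_level_set j [set y] [set x; z].
- by rewrite disjoints1 !inE negb_or yx.
- by rewrite cards1.
- by rewrite cards2; case: (_ != _); lia.
rewrite sub1set disjoint_sym disjoints_subset subUset !sub1set !inE.
by move=> /andP[? /andP[? ?]]; exists A.
Qed.

End LevelSets.

(** * Third colours, and what a level with only the colours [a] and [b] forces *)

Section Coloring.
Variables (n e : nat).
Hypotheses (nE : n = 2 * e + 2) (e_gt1 : 1 < e).

Let nQ : (n%:R = 2 * e%:R + 2 :> rat)%R.
Proof. by rewrite nE natrD natrM. Qed.

Variable c : {set 'I_n} -> nat.
Hypotheses (rf : no_rainbow_antichain3 c) (light : light_classes e c).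

(** The empty and the full set are excluded because they are comparable to every set. *)
Definition third_color a b X :=
  [&& X != set0, X != setT, c X != a & c X != b].

Lemma third_colorC a b X : third_color a b X = third_color b a X.
Proof. by rewrite /third_color; do 2!congr (_ && _); rewrite andbC. Qed.

(** Otherwise the classes of [a] and [b], with the empty and the full set, would cover [B_n], whose
    mass [n+1 = 2e+3] exceeds [e+e+1+1]. *)
Lemma exists_third_color a b : exists X, third_color a b X.
Proof.
apply/existsP; apply: contraT; rewrite negb_exists => /forallP noX.
have sub : setT \subset (color_class c a :|: color_class c b)
    :|: ([set set0] :|: [set setT]).
  apply/subsetP=> X _; have := noX X; rewrite !negb_and !negbK !inE.
  by do 4?case: (_ == _).
have := le_trans (lubell_massS sub) (lubell_massU _ _).
have := lubell_massU (color_class c a) (color_class c b).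
have := lubell_massU [set (set0 : {set 'I_n})] [set setT].
have := light a; have := light b.
rewrite !lubell_mass1 cards0 cardsT card_ord bin0 binn invr1 lubell_massT.
by rewrite -(natr1 n) nQ; lra.
Qed.

Section BichromaticLevel.
Variables (j : nat) (a b : nat).
Hypotheses (j_gt1 : 1 < j) (j_lt : j.+1 < n) (neq_ab : a != b).

(** All sets avoiding [x], save the empty set and the complement of [{x}], get colour [b]. The sets
    avoiding [x] have mass [(n+1)/2 = e+3/2], and the two exceptions account for only [1+1/n]. *)
Lemma dictator_false x :
  third_color a b [set x] ->
  (forall A : {set 'I_n}, #|A| = j -> x \in A -> c A = a) ->
  (forall B : {set 'I_n}, #|B| = j -> x \notin B -> c B = b) -> False.
Proof.
move=> /and4P[_ _ xa xb] cA cB.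
(* X with a suitable a-set A and b-set B allows only the colours a and b for X;
   X with {x} and B only b and that of {x}. *)
have colX (X : {set 'I_n}) :
    x \notin X -> X != set0 -> X != ~: [set x] -> c X = b.
  move=> xX /set0Pn[y yX] nX.
  have xy : x != y by apply: contraNneq xX => ->.
  have [z zX zx] : exists2 z, z \notin X & x != z.
    have /subsetPn[z] : ~~ (~: [set x] \subset X).
      apply: contra nX => sub; rewrite eqEsubset sub andbT.
      by rewrite subsetC sub1set inE.
    by rewrite !inE => zx zX; exists z; rewrite // eq_sym.
  have [A [Aj xA zA yA]] : exists A : {set 'I_n},
      [/\ #|A| = j, x \in A, x \in A & y \notin A].
    by apply: exists_level_set21; rewrite 1?eq_sym //; lia.
  have [B Bj /and3P[zB yB xB]] : exists2 B : {set 'I_n},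
      #|B| = j & [&& z \in B, y \notin B & x \notin B].
    have [|||B [? ? ? ?]] := @exists_level_set12 n j z y x _ j_lt.
    - exact: ltnW.
    - by apply: contraNneq zX => ->.
    - by rewrite eq_sym.
    by exists B => //; apply/and3P.
  have cAa := cA _ Aj xA; have cBb := cB _ Bj xB.
  have XA : incomparable X A by apply: (incomparableI yX yA xA).
  have XB : incomparable X B by apply: (incomparableI yX yB zB).
  have AB : incomparable A B.
    by apply: incomparable_card; [rewrite Aj|apply: contraNneq xB => <-].
  have Xx : incomparable X [set x].
    by apply: (@incomparableI _ _ _ y x); rewrite ?inE // eq_sym.
  have Bx : incomparable B [set x].
    by apply: (@incomparableI _ _ _ z x); rewrite ?inE // eq_sym.
  apply/eqP/negPn/negP=> Xb.
  apply: (rf XB Xx Bx); rewrite ?cBb // 1?[b == _]eq_sym //.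
  apply/negP=> Xcx; apply: (rf XA XB AB); rewrite ?cAa ?cBb //.
  by rewrite (eqP Xcx).
have sub : powerset (~: [set x]) \subset
    color_class c b :|: ([set set0] :|: [set ~: [set x]]).
  apply/subsetP=> X; rewrite !inE subsetC sub1set inE => xX.
  case: eqP => [//|/eqP Xb] /=; apply: contraT; rewrite negb_or => /andP[X0 X1].
  by rewrite colX ?eqxx in Xb.
have := le_trans (lubell_massS sub) (lubell_massU _ _).
have := lubell_massU [set (set0 : {set 'I_n})] [set ~: [set x]].
have := light b.
rewrite !lubell_mass1 lubell_mass_powerset cards0 card_setC_ord cards1 bin0.
rewrite bin_sub ?bin1; last by lia.
rewrite invr1 subKn; last by lia.
have : (n%:R^-1 <= 6%:R^-1 :> rat)%R.
  by rewrite lef_pV2 ?ler_nat ?posrE ?ltr0n; lia.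
by rewrite -(natr1 n) nQ; lra.
Qed.


(** Outside the class of [a] there are at most the singletons outside [S] and the subsets and
    supersets of [S]; by [star_mass_lt] this leaves mass more than [e] for the colour [a]. *)
Lemma incomparable_mono_false (S : {set 'I_n}) : 1 < #|S| -> S != setT ->
  (forall X : {set 'I_n}, 1 < #|X| -> incomparable X S -> c X = a) -> False.
Proof.
move=> S_gt1 ST colX.
pose L := [set [set x] | x in ~: S].
have sub : setT \subset (color_class c a :|: L)
    :|: (powerset S :|: [set A : {set 'I_n} | S \subset A]).
  apply/subsetP=> X _; rewrite !inE.
  case XS: (X \subset S); first by rewrite orbT.
  case SX: (S \subset X); first by rewrite !orbT.
  rewrite !orbF; have [X1|X1] := ltnP 1 #|X|.
    by rewrite colX ?eqxx // /incomparable XS SX.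
  have /cards1P[x Xx] : #|X| == 1.
    rewrite eqn_leq X1 card_gt0; apply: contraFneq XS => ->; exact: sub0set.
  rewrite Xx imset_f ?orbT // inE; apply: contraFN XS.
  by rewrite Xx sub1set.
have massL : (lubell_mass L = (n - #|S|)%:R / n%:R)%R.
  rewrite /lubell_mass big_imset /=; last by move=> x y _ _ /set1_inj.
  rewrite (eq_bigr (fun=> n%:R^-1)%R) => [|x _]; last by rewrite cards1 bin1.
  by rewrite sumr_const card_setC_ord -[LHS]mulr_natl.
have := le_trans (lubell_massS sub) (lubell_massU _ _).
have := lubell_massU (color_class c a) L.
have := lubell_massU (powerset S) [set A : {set 'I_n} | S \subset A].
have := light a.
rewrite lubell_massT lubell_mass_powerset lubell_mass_supersets massL.
have S_ltn : #|S| < n.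
  by rewrite ltn_neqAle card_leq_ord andbT -[X in _ != X]card_ord -cardsT
    (contra_neq _ ST) // => eqS; apply/eqP; rewrite eqEcard subsetT eqS leqnn.
have := star_mass_lt nE e_gt1 (introT andP (conj S_gt1 S_ltn)).
set p := (_ / (n - _).+1%:R)%R; set q := (n.+1%:R / _)%R.
set r := (_ / n%:R)%R.
by move: p q r => p q r; lra.
Qed.

Lemma star_above_false (B0 C0 : {set 'I_n}) :
  (forall A : {set 'I_n}, #|A| = j -> c A = a \/ c A = b) ->
  (forall C B : {set 'I_n}, third_color a b C -> #|B| = j -> c B = b ->
    ~~ incomparable B C) ->
  #|B0| = j -> c B0 = b -> third_color a b C0 -> B0 \subset C0 -> False.
Proof.
move=> cA friend B0j cB0 C0t sBC0.
(* S separates: sets of colour other than a lie below all C of the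
   intersection, or above one of them. *)
pose S := \bigcap_(C | third_color a b C && (B0 \subset C)) C.
have third_sub (C X : {set 'I_n}) : third_color a b C -> B0 \subset C -> #|X| > 1 ->
    c X = b -> ~~ incomparable X C.
  move=> Ct sBC X_gt1 cX; apply/negP=> XC.
  have /and4P[_ _ Ca Cb] := Ct.
  have /andP[/subsetPn[u uX uC] /subsetPn[y yC yX]] := XC.
  have [z /andP[zX zu]] : exists z, (z \in X) && (z != u).
    have /card_gt0P[z] : 0 < #|X :\ u| by rewrite (cardsD1 u) uX in X_gt1.
    by rewrite !inE andbC; exists z.
  (* [A] contains [y] and [u] but not [z], so it is incomparable to [X] and, since [j < #|C|], to
     [C]. Colour [a] for [A] gives a rainbow antichain, colour [b] contradicts [friend]. *)
  have [|||A [Aj yA uA zA]] := @exists_level_set21 n j y u z j_gt1.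
  - exact: ltnW.
  - by apply: contraNneq yX => <-.
  - exact: zu.
  have jC : j < #|C|.
    rewrite -B0j proper_card // properEneq sBC andbT.
    by apply: contra_neq Cb => <-.
  have AC : incomparable A C.
    apply: contraT => /comparable_leq_card; rewrite Aj => /(_ jC)/subsetP/(_ _ uA).
    by rewrite (negPf uC).
  have AX : incomparable A X by apply: (incomparableI yA yX zX zA).
  have [cAa|cAb] := cA A Aj; last by move: (friend C A Ct Aj cAb); rewrite AC.
  by apply: (rf AX AC XC); rewrite ?cAa ?cX // 1?eq_sym.
have sB0S : B0 \subset S by apply/bigcapsP=> C /andP[].
have S_sub (C : {set 'I_n}) : third_color a b C -> B0 \subset C -> S \subset C.
  by move=> Ct sBC; apply: bigcap_inf; rewrite Ct.
have S_gt1 : 1 < #|S| by rewrite (leq_trans _ (subset_leq_card sB0S)) ?B0j.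
have ST : S != setT.
  have /and4P[_ CT _ _] := C0t; apply: contra_neq CT => ST; apply/eqP.
  by rewrite eqEsubset subsetT -ST S_sub.
apply: (incomparable_mono_false S_gt1 ST) => X X_gt1 XS.
apply/eqP/negPn/negP=> Xa; have /andP[nXS nSX] := XS.
(* If [X] has colour [b], some [C] of the intersection fails to contain it, so [X] contains that [C]
   and hence [S]. *)
have [Xb|Xb] := eqVneq (c X) b.
  have /bigcapsP := nXS; apply=> C /andP[Ct sBC].
  move: (third_sub C X Ct sBC X_gt1 Xb); rewrite negb_and !negbK => /orP[//|sCX].
  by case/negP: nSX; apply: subset_trans (S_sub C Ct sBC) sCX.
have Xt : third_color a b X.
  rewrite /third_color Xa Xb -card_gt0 (ltnW X_gt1) /= andbT.
  by apply: contraNneq nSX => ->; rewrite subsetT.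
(* A third-colour [X] is comparable to [B0]: above it, [X] is one of the sets intersected; below it,
   [X] lies in [S]. *)
move: (friend X B0 Xt B0j cB0); rewrite negb_and !negbK => /orP[sBX|sXB].
  by case/negP: nSX; apply: S_sub.
by case/negP: nXS; apply: subset_trans sB0S.
Qed.

End BichromaticLevel.
End Coloring.

(** * Excluding light colourings without a rainbow antichain of size 3 *)

Section NoLightColoring.
Variables (n e : nat).
Hypotheses (nE : n = 2 * e + 2) (e_gt1 : 1 < e).
Variable c : {set 'I_n} -> nat.
Hypotheses (rf : no_rainbow_antichain3 c) (light : light_classes e c).

(** Complementation reduces this to [star_above_false] on level [n-j]. *)
Lemma star_below_false j a b (B0 C0 : {set 'I_n}) :
  1 < j -> j.+1 < n -> a != b ->
  (forall A : {set 'I_n}, #|A| = j -> c A = a \/ c A = b) ->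
  (forall C B : {set 'I_n}, third_color c a b C -> #|B| = j -> c B = b ->
    ~~ incomparable B C) ->
  #|B0| = j -> c B0 = b -> third_color c a b C0 -> C0 \subset B0 -> False.
Proof.
move=> j_gt1 j_lt neq_ab cA friend B0j cB0 C0t sCB.
have thirdC X : third_color (fun Y => c (~: Y)) a b X = third_color c a b (~: X).
  rewrite /third_color andbCA -[X == setT](inj_eq (@setC_inj _)) setCT.
  by rewrite -[X == set0](inj_eq (@setC_inj _)) setC0.
apply: (@star_above_false n e nE e_gt1 _ (no_rainbow_antichain3C rf)
  (light_classesC light) (n - j) a b _ _ neq_ab (~: B0) (~: C0)).
- by lia.
- by lia.
- by move=> A Aj; apply: cA; rewrite card_setC_ord Aj; lia.
- move=> C B; rewrite thirdC => Ct Bj cB; rewrite -incomparableC.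
  by apply: friend => //; rewrite card_setC_ord Bj; lia.
- by rewrite card_setC_ord B0j.
- by rewrite setCK.
- by rewrite thirdC setCK.
- by rewrite setCS.
Qed.

Lemma friendly_color_false j a b (B0 : {set 'I_n}) :
  1 < j -> j.+1 < n -> a != b ->
  (forall A : {set 'I_n}, #|A| = j -> c A = a \/ c A = b) ->
  (forall C B : {set 'I_n}, third_color c a b C -> #|B| = j -> c B = b ->
    ~~ incomparable B C) ->
  #|B0| = j -> c B0 = b -> False.
Proof.
move=> j_gt1 j_lt neq_ab cA friend B0j cB0.
have [C0 C0t] := exists_third_color nE light a b.
move: (friend C0 B0 C0t B0j cB0); rewrite negb_and !negbK => /orP[sBC|sCB].
  exact: (star_above_false nE e_gt1 rf light j_gt1 j_lt neq_ab cA friend B0j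
    cB0 C0t sBC).
exact: (star_below_false j_gt1 j_lt neq_ab cA friend B0j cB0 C0t sCB).
Qed.

(** If [y] outside [C'] and [z] in [C] were distinct, a [j]-set containing [y] but not [z] could
    have neither colour. So [C] is a singleton [{x}] with [x] outside [C'], and membership of [x]
    decides the colours on level [j]. *)
Lemma mixed_friends_false j a b (C C' : {set 'I_n}) :
  1 < j -> j.+1 < n -> a != b ->
  (forall A : {set 'I_n}, #|A| = j -> c A = a \/ c A = b) ->
  third_color c a b C -> third_color c a b C' -> #|C| < j -> j < #|C'| ->
  (forall A : {set 'I_n}, #|A| = j -> c A = a -> C \subset A) ->
  (forall B : {set 'I_n}, #|B| = j -> c B = b -> B \subset C') -> False.
Proof.
move=> j_gt1 j_lt neq_ab cA Ct C't Cj C'j aC bC'.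
have /and4P[/set0Pn[x xC] _ _ _] := Ct.
have /and4P[_ C'T _ _] := C't.
have outE y z : y \notin C' -> z \in C -> y = z.
  move=> yC' zC; apply/eqP/negPn/negP=> yz.
  have [|||A [Aj yA zA _]] := @exists_level_set12 n j y z z _ j_lt => //.
    exact: ltnW.
  have [cAa|cAb] := cA A Aj.
    by move/subsetP/(_ _ zC): (aC A Aj cAa); rewrite (negPf zA).
  by move/subsetP/(_ _ yA): (bC' A Aj cAb); rewrite (negPf yC').
have xC' : x \notin C'.
  have /subsetPn[y _ yC'] : ~~ (setT \subset C') by rewrite subTset.
  by rewrite -(outE y x yC' xC).
have CE : C = [set x].
  apply/setP=> z; rewrite inE; apply/idP/eqP=> [zC|->//].
  exact/esym/outE.
rewrite CE in Ct.
apply: (dictator_false nE e_gt1 rf light j_gt1 j_lt neq_ab Ct) => A Aj xA.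
  have [//|cAb] := cA A Aj.
  by move/subsetP/(_ _ xA): (bC' A Aj cAb); rewrite (negPf xC').
have [cAa|//] := cA A Aj.
by move: (aC A Aj cAa); rewrite CE sub1set (negPf xA).
Qed.

Lemma bichromatic_level_false j (A1 B1 : {set 'I_n}) :
  1 < j -> j.+1 < n -> #|A1| = j -> #|B1| = j -> c A1 != c B1 -> False.
Proof.
move=> j_gt1 j_lt A1j B1j.
set a := c A1; set b := c B1 => neq_ab.
have cA (A : {set 'I_n}) : #|A| = j -> c A = a \/ c A = b.
  move=> Aj; have [|Aa] := eqVneq (c A) a; first by left.
  have [|Ab] := eqVneq (c A) b; first by right.
  case: (@rf A A1 B1); rewrite ?incomparable_card ?Aj //.
  - by apply: contraNneq Aa => ->.
  - by apply: contraNneq Ab => ->.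
  - by rewrite A1j.
  - by apply: contraNneq neq_ab => eqAB; rewrite /a eqAB.
have third_card (C : {set 'I_n}) : third_color c a b C -> #|C| != j.
  case/and4P=> _ _ /eqP Ca /eqP Cb; apply/negP=> /eqP Cj.
  by case: (cA C Cj).
have third_friend (C A B : {set 'I_n}) : third_color c a b C -> #|A| = j -> #|B| = j ->
    c A = a -> c B = b -> incomparable A C -> ~~ incomparable B C.
  move=> /and4P[_ _ Ca Cb] Aj Bj cAa cBb AC; apply/negP=> BC.
  apply: (@rf A B C); rewrite ?cAa ?cBb // 1?eq_sym //.
  apply: incomparable_card; rewrite ?Aj ?Bj //.
  by apply: contraNneq neq_ab => eqAB; rewrite -cAa eqAB cBb.
(* Either every third-colour set is comparable to all [b]-sets of the level, or some [C] is
   incomparable to a [b]-set and thus comparable to all [a]-sets. Exchanging [a] and [b] gives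
   [C']. *)
have [friend_b|] := pselect (forall C B : {set 'I_n}, third_color c a b C ->
    #|B| = j -> c B = b -> ~~ incomparable B C).
  exact: (friendly_color_false j_gt1 j_lt neq_ab cA friend_b B1j).
move=> /existsNP[C /existsNP[B]] /not_implyP[Ct].
move=> /not_implyP[Bj] /not_implyP[cBb] /negP; rewrite negbK => BC.
have [friend_a|] := pselect (forall C A : {set 'I_n}, third_color c b a C ->
    #|A| = j -> c A = a -> ~~ incomparable A C).
  apply: (friendly_color_false j_gt1 j_lt _ _ friend_a A1j); rewrite // 1?eq_sym //.
  by move=> A /cA[]; [right|left].
move=> /existsNP[C' /existsNP[A]]; rewrite third_colorC => /not_implyP[C't].
move=> /not_implyP[Aj] /not_implyP[cAa] /negP; rewrite negbK => AC'.
have aC (X : {set 'I_n}) : #|X| = j -> c X = a -> ~~ incomparable X C.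
  by move=> Xj cX; apply/negP=> XC; move: (third_friend C X B Ct Xj Bj cX cBb XC);
    rewrite BC.
have bC' (X : {set 'I_n}) : #|X| = j -> c X = b -> ~~ incomparable X C'.
  by move=> Xj cX; apply: (third_friend C' A X).
have := third_card C Ct; have := third_card C' C't.
(* If [C] and [C'] are both smaller than [j], a [j]-set missing a point of each can have neither
   colour; if both are larger, use a [j]-set with a point outside each. Otherwise
   [mixed_friends_false] applies. *)
rewrite !neq_ltn => /orP[C'j|jC'] /orP[Cj|jC].
- have /and4P[/set0Pn[x xC] _ _ _] := Ct.
  have /and4P[/set0Pn[y yC'] _ _ _] := C't.
  have [|||X Xj] := @exists_level_set n j set0 [set x; y].
  - by rewrite disjoints_subset sub0set.
  - by rewrite cards0.
  - by rewrite cards2; case: (_ != _); lia.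
  rewrite disjoint_sym disjoints_subset subUset !sub1set !inE.
  move=> /and3P[_ xX yX]; have [cX|cX] := cA X Xj.
    move: (aC X Xj cX); rewrite incomparable_sym => /comparable_leq_card.
    by rewrite Xj => /(_ Cj)/subsetP/(_ _ xC); rewrite (negPf xX).
  move: (bC' X Xj cX); rewrite incomparable_sym => /comparable_leq_card.
  by rewrite Xj => /(_ C'j)/subsetP/(_ _ yC'); rewrite (negPf yX).
- apply: (@mixed_friends_false j b a C' C) => //; rewrite 1?eq_sym //.
  + by move=> X /cA[]; [right|left].
  + by rewrite third_colorC.
  + by rewrite third_colorC.
  + move=> X Xj cX; move: (bC' X Xj cX); rewrite incomparable_sym.
    by move/comparable_leq_card; apply; rewrite Xj.
  + by move=> X Xj cX; apply: comparable_leq_card (aC X Xj cX) _; rewrite Xj.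
- apply: (@mixed_friends_false j a b C C') => //.
  + move=> X Xj cX; move: (aC X Xj cX); rewrite incomparable_sym.
    by move/comparable_leq_card; apply; rewrite Xj.
  + by move=> X Xj cX; apply: comparable_leq_card (bC' X Xj cX) _; rewrite Xj.
have /and4P[_ CT _ _] := Ct; have /and4P[_ C'T _ _] := C't.
have /subsetPn[x _ xC] : ~~ (setT \subset C) by rewrite subTset.
have /subsetPn[y _ yC'] : ~~ (setT \subset C') by rewrite subTset.
have [|||X Xj] := @exists_level_set n j [set x; y] set0.
- by rewrite disjoint_sym disjoints_subset sub0set.
- by rewrite cards2; case: (_ != _); lia.
- by rewrite cards0; lia.
rewrite subUset !sub1set => /andP[/andP[xX yX] _]; have [cX|cX] := cA X Xj.
  move: (aC X Xj cX) => /comparable_leq_card.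
  by rewrite Xj => /(_ jC)/subsetP/(_ _ xX); rewrite (negPf xC).
move: (bC' X Xj cX) => /comparable_leq_card.
by rewrite Xj => /(_ jC')/subsetP/(_ _ yX); rewrite (negPf yC').
Qed.

Lemma no_light_coloring : False.
Proof.
have [X0 X0j] : exists X0 : {set 'I_n}, #|X0| = 2.
  have [|||X Xj _] := @exists_level_set n 2 set0 set0; last by exists X.
  - by rewrite disjoints_subset sub0set.
  - by rewrite cards0.
  - by rewrite cards0; lia.
have mono i (X Y : {set 'I_n}) : 1 < i -> i.+1 < n -> #|X| = i -> #|Y| = i -> c X = c Y.
  move=> i_gt1 i_lt Xi Yi; apply/eqP/negPn/negP.
  exact: (bichromatic_level_false i_gt1 i_lt Xi Yi).
have [allX0|] := pselect (forall Y : {set 'I_n}, 1 < #|Y| -> #|Y|.+1 < n ->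
    c Y = c X0).
  pose level k := [set A : {set 'I_n} | #|A| == k].
  (* The levels 0, 1, [n-1] and [n] add at most 4 to the mass of one colour, but
     [n+1 = 2e+3 > e+4]. *)
  have sub : setT \subset color_class c (c X0)
      :|: ((level 0 :|: level 1) :|: (level n.-1 :|: level n)).
    apply/subsetP=> Y _; rewrite !inE; apply: contraT.
    rewrite !negb_or => /andP[cY Yn].
    by case/negP: cY; apply/eqP/allX0; have := card_leq_ord Y; lia.
  have := le_trans (lubell_massS sub) (lubell_massU _ _).
  have := lubell_massU (level 0 :|: level 1) (level n.-1 :|: level n).
  have := lubell_massU (level 0) (level 1).
  have := lubell_massU (level n.-1) (level n).
  have := light (c X0).
  rewrite !lubell_mass_level; try lia.
  have e2 : (2 <= e%:R :> rat)%R by rewrite (ler_nat _ 2).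
  rewrite lubell_massT -natr1.
  have -> : (n%:R = 2 * e%:R + 2 :> rat)%R by rewrite nE natrD natrM.
  by lra.
move=> /existsNP[Y0 /not_implyP[Y0_gt1 /not_implyP[Y0_lt /eqP Y0X0]]].
have [C /and4P[C0 CT CX CY]] := exists_third_color nE light (c X0) (c Y0).
(* On three points, one of them distinguishing C, the traces of C, X and Y can
   be chosen to be the three singletons, or the three pairs if #|C| = n-1. *)
suff [X [Y [X2 Yj XC YC XY]]] : exists X Y : {set 'I_n},
    [/\ #|X| = 2, #|Y| = #|Y0|, incomparable X C, incomparable Y C
      & incomparable X Y].
  have cX : c X = c X0 by apply: (mono 2) => //; lia.
  have cY : c Y = c Y0 by apply: (mono #|Y0|).
  by apply: (rf XY XC YC); rewrite ?cX ?cY // eq_sym.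
have [C_lt|C_ge] := ltnP #|C|.+1 n.
  have /set0Pn[p pC] := C0.
  have [q [r [qC rC qr]]] : exists q r, [/\ q \notin C, r \notin C & q != r].
    have /card_gt1P[q [r []]] : 1 < #|~: C| by rewrite card_setC_ord; lia.
    by rewrite !inE => qC rC qr; exists q, r.
  have pq : q != p by apply: contraNneq qC => ->.
  have pr : r != p by apply: contraNneq rC => ->.
  have [X [X2 qX pX rX]] : exists X : {set 'I_n},
      [/\ #|X| = 2, q \in X, p \notin X & r \notin X].
    by apply: exists_level_set12 => //; lia.
  have [Y [Yj rY pY qY]] : exists Y : {set 'I_n},
      [/\ #|Y| = #|Y0|, r \in Y, p \notin Y & q \notin Y].
    by apply: exists_level_set12; rewrite 1?[r == q]eq_sym //; lia.
  exists X, Y; split=> //.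
  - exact: incomparableI qX qC pC pX.
  - exact: incomparableI rY rC pC pY.
  - exact: incomparableI qX qY rY rX.
have /subsetPn[p _ pC] : ~~ (setT \subset C) by rewrite subTset.
have /card_gt1P[q [r [qC rC qr]]] : 1 < #|C| by lia.
have pq : q != p by apply: contraTneq qC => ->.
have pr : r != p by apply: contraTneq rC => ->.
have [X [X2 pX rX qX]] : exists X : {set 'I_n},
    [/\ #|X| = 2, p \in X, r \in X & q \notin X].
  by apply: exists_level_set21 => //; lia.
have [Y [Yj pY qY rY]] : exists Y : {set 'I_n},
    [/\ #|Y| = #|Y0|, p \in Y, q \in Y & r \notin Y].
  by apply: exists_level_set21; rewrite 1?[r == q]eq_sym //; lia.
exists X, Y; split=> //.
- exact: incomparableI pX pC qC qX.
- exact: incomparableI pY pC rC rY.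
- exact: incomparableI rX rY qY qX.
Qed.

End NoLightColoring.

Lemma le_set_subset (T : finType) (A B : {set T}) :
  (A <= B)%O = (A \subset B).
Proof. by []. Qed.

(** * Strong copies and monotonicity of the Ramsey property in [n] *)

Section StrongCopies.
Variables (d d' : Order.disp_t) (P : finPOrderType d) (R : finPOrderType d').
Implicit Types (X F : {set R}).

Lemma strong_copyP X :
  reflect (exists2 f : P -> R, {mono f : p q / (p <= q)%O} & f @: P = X)
    (strong_copy P X).
Proof.
apply: (iffP existsP) => [[f /and3P[_ /eqP fX /'forall_forallP monof]]|[f monof fX]].
  by exists f => // p q; rewrite -(eqP (monof p q)).
exists [ffun p => f p]; apply/and3P; split.
- apply/injectiveP=> p q; rewrite !ffunE => eq_pq.
  by apply/le_anti; rewrite -!monof eq_pq lexx.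
- by rewrite -fX; apply/eqP/eq_imset=> p; rewrite ffunE.
- by apply/'forall_forallP=> p q; rewrite !ffunE monof.
Qed.

Lemma strong_copy_not_free X F :
  X \subset F -> strong_copy P X -> ~~ induced_free P F.
Proof.
by move=> sXF copyX; rewrite negbK; apply/existsP; exists X; rewrite sXF.
Qed.

Lemma strong_copy_card X : strong_copy P X -> #|X| = #|P|.
Proof.
case/strong_copyP=> f monof <-; rewrite card_imset // => p q eq_pq.
by apply/le_anti; rewrite -!monof eq_pq lexx.
Qed.

End StrongCopies.

Lemma strong_copy_imset d d1 d2 (P : finPOrderType d) (R1 : finPOrderType d1)
    (R2 : finPOrderType d2) (g : R1 -> R2) (X : {set R1}) :
  {mono g : A B / (A <= B)%O} -> strong_copy P X -> strong_copy P (g @: X).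
Proof.
move=> monog /strong_copyP[f monof <-]; apply/strong_copyP.
exists (g \o f) => [p q|]; first by rewrite /= monog monof.
by rewrite imset_comp.
Qed.

(** [B_m] embeds in [B_n], and a colouring of [B_n] is pulled back. Hence one bad colouring of
    [B_(2e+1)] settles all smaller dimensions. *)
Lemma rainbow_ramsey_propW d d' (P : finPOrderType d) (Q : finPOrderType d') m n :
  m <= n -> rainbow_ramsey_prop P Q m -> rainbow_ramsey_prop P Q n.
Proof.
move=> le_mn ramsey c.
pose g (A : {set 'I_m}) : {set 'I_n} := widen_ord le_mn @: A.
have monog : {mono g : A B / (A <= B)%O}.
  move=> A B; rewrite !le_set_subset; apply/idP/idP=> [sAB|]; last exact: imsetS.
  apply/subsetP=> i iA; have : widen_ord le_mn i \in g B.
    by rewrite (subsetP sAB) // imset_f.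
  by case/imsetP=> k kB /(congr1 val)/= /val_inj ->.
have [[X copyX monoX]|[X copyX rainbowX]] := ramsey (c \o g); [left|right].
  exists (g @: X); first exact: strong_copy_imset.
  by move=> _ _ /imsetP[A AX ->] /imsetP[B BX ->]; apply: monoX.
exists (g @: X); first exact: strong_copy_imset.
by move=> _ _ /imsetP[A AX ->] /imsetP[B BX ->] /(rainbowX A B AX BX) ->.
Qed.

Section Posets.
Variables (d : Order.disp_t) (P : finPOrderType d).

Lemma poset_iso_ord1 : #|P| = 1 -> poset_iso P 'I_1.
Proof.
move/eqP/fintype1P=> [x xP]; exists (fun=> ord0).
  by exists (fun=> x) => [y|i]; rewrite ?ord1 ?xP // [RHS]xP.
by move=> y z; rewrite (xP y) (xP z) !lexx.
Qed.

(** [B_1] is a two-element chain ranked by size, and an embedding of at least two points into it is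
    onto. *)
Lemma copy_B1_iso (X : {set {set 'I_1}}) :
  strong_copy P X -> 1 < #|P| -> poset_iso P 'I_2.
Proof.
move=> copyX P_gt1; have /strong_copyP[f monof _] := copyX.
have card_f p : #|f p| < 2 by rewrite ltnS -[leqRHS]card_ord max_card.
pose h p : 'I_2 := Ordinal (card_f p).
have monoh : {mono h : p q / (p <= q)%O}.
  move=> p q; rewrite -monof le_set_subset (_ : (h p <= h q)%O = (#|f p| <= #|f q|)) //.
  apply/idP/idP=> [le_pq|]; last exact: subset_leq_card.
  have [fq0|fq_gt0] := posnP #|f q|.
    by move: le_pq; rewrite fq0 leqn0 cards_eq0 => /eqP ->; rewrite sub0set.
  suff -> : f q = setT by rewrite subsetT.
  by apply/eqP; rewrite eqEcard subsetT cardsT card_ord.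
exists h => //; apply: inj_card_bij; last by rewrite card_ord.
by move=> p q eq_pq; apply/le_anti; rewrite -!monoh eq_pq lexx.
Qed.

End Posets.

(** * The two bounds on the Ramsey number *)

Section Corollary.
Variables (d : Order.disp_t) (P : finPOrderType d) (P_gt0 : 0 < #|P|).
Hypotheses (lubell_bounded : uniformly_induced_lubell_bounded P_gt0)
  (P_not1 : ~ poset_iso P 'I_1) (P_not2 : ~ poset_iso P 'I_2).
Local Notation e := (e_star P_gt0).

Lemma card_poset_gt1 : 1 < #|P|.
Proof.
rewrite ltn_neqAle P_gt0 andbT eq_sym; apply/eqP=> P1.
exact/P_not1/poset_iso_ord1.
Qed.

Lemma induced_free_mass n (F : {set {set 'I_n}}) : 0 < n ->
  induced_free P F -> (lubell_mass F <= e%:R)%R.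
Proof.
move=> n_gt0 freeF; apply: le_trans (lubell_bounded n_gt0).
by rewrite /lambda_star (bigD1 F) //= le_max lexx.
Qed.

(** The whole of [B_1] is induced [P]-free and has mass 2. *)
Lemma e_star_gt1 : 1 < e.
Proof.
rewrite -(ler_nat rat) -(lubell_massT 1) induced_free_mass //.
apply/existsP=> -[X /andP[_ copyX]].
exact: (P_not2 (copy_B1_iso copyX card_poset_gt1)).
Qed.

Lemma lubell_bounded_upper : rainbow_ramsey_prop P (antichain 3) (2 + 2 * e).
Proof.
move=> c; apply: contrapT => /not_orP[noP noA].
apply: (@no_light_coloring (2 + 2 * e) e _ e_star_gt1 c).
- by rewrite addnC.
- move=> X Y Z XY XZ YZ cXY cXZ cYZ; apply: noA.
  pose f (i : antichain 3) := nth X [:: X; Y; Z] i.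
  have f_le i k : (f i <= f k)%O = (i <= k)%O.
    have /andP[/negPf XYl /negPf XYr] := XY.
    have /andP[/negPf XZl /negPf XZr] := XZ.
    have /andP[/negPf YZl /negPf YZr] := YZ.
    rewrite le_set_subset [RHS]/Order.le /= -val_eqE /f.
    by case: i k => [[|[|[|//]]] ?] [[|[|[|//]]] ?] /=;
      rewrite ?subxx ?XYl ?XYr ?XZl ?XZr ?YZl ?YZr.
  have f_inj i k : c (f i) = c (f k) -> f i = f k.
    by rewrite /f; case: i k => [[|[|[|//]]] ?] [[|[|[|//]]] ?] //= /eqP;
      rewrite ?(negPf cXY) ?(negPf cXZ) ?(negPf cYZ) // eq_sym;
      rewrite ?(negPf cXY) ?(negPf cXZ) ?(negPf cYZ).
  exists [set f i | i : antichain 3]; first by apply/strong_copyP; exists f.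
  by move=> _ _ /imsetP[i _ ->] /imsetP[k _ ->]; apply: f_inj.
(* A copy of [P] inside a colour class would be monochromatic. *)
- move=> a; apply: induced_free_mass => //.
  apply/existsP=> -[X /andP[sXc copyX]].
  apply: noP; exists X => // A B /(subsetP sXc) + /(subsetP sXc).
  by rewrite !inE => /eqP -> /eqP ->.
Qed.

Lemma lubell_bounded_lower :
  ~ rainbow_ramsey_prop P (antichain 3) (2 * e).+1.
Proof.
pose c (A : {set 'I_(2 * e).+1}) :=
  if #|A| == 0 then 0 else if #|A| <= e then 1 else if #|A| <= 2 * e then 2 else 3.
have [free _] := e_starP P_gt0.
have P_gt1 := card_poset_gt1.
move=> /(_ c)[[X copyX monoX]|[X copyX rainbowX]].
  have cardX := strong_copy_card copyX.
  have /card_gt0P[A AX] : 0 < #|X| by rewrite cardX.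
  have level_false k : k + e <= (2 * e).+2 ->
      (forall B, c B = c A -> k <= #|B| < k + e) -> False.
    move=> le_k ck; apply/negP: (free _ _ le_k).
    apply: strong_copy_not_free copyX.
    by apply/subsetP=> B BX; rewrite inE ck // (monoX B A).
  (* Colours 0 and 3 occur on one set each, while [P] has at least two points. *)
  have single_false S : (forall B, c B = c A -> B = S) -> False.
    move=> cS; have /subset_leq_card : X \subset [set S].
      by apply/subsetP=> B BX; rewrite inE (cS B) // (monoX B A).
    by rewrite cards1 cardX leqNgt P_gt1.
  have cA := erefl (c A); rewrite {2}/c in cA; move: cA.
  case: eqP => [_ cA|/eqP A0].
    apply: (single_false set0) => B; rewrite cA /c.
    by case: eqP => [/cards0_eq//|_]; do 2?case: ifP.
  case: ifP => [Ae cA|/negbT Ae].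
    apply: (level_false 1); first by lia.
    by move=> B; rewrite cA /c; do 3?[case: ifP => //]; lia.
  case: ifP => [A2e cA|/negbT A2e cA].
    apply: (level_false e.+1); first by lia.
    by move=> B; rewrite cA /c; do 3?[case: ifP => //]; lia.
  apply: (single_false setT) => B; rewrite cA /c.
  do 3?[case: ifP => //] => B2e _ _ _; apply/eqP.
  rewrite eqEcard subsetT cardsT card_ord; lia.
have /strong_copyP[f monof fX] := copyX.
(* Each member of the antichain has an incomparable partner, so it is neither empty nor full; only
   two colours remain for three sets. *)
have c12 i : c (f i) = 1 \/ c (f i) = 2.
  have [k ki] : exists k, k != i.
    have [->|i0] := eqVneq i (ord0 : 'I_3); first by exists (ord_max : 'I_3).
    by exists (ord0 : 'I_3); rewrite eq_sym.
  have /andP[nfi nfk] : incomparable (f i) (f k).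
    have : ~~ (f i <= f k)%O by rewrite monof /Order.le /= eq_sym.
    have : ~~ (f k <= f i)%O by rewrite monof /Order.le /=.
    by rewrite !le_set_subset /incomparable => -> ->.
  rewrite /c; case: eqP => [/cards0_eq fi0|_].
    by rewrite fi0 sub0set in nfi.
  case: ifP => _; first by left.
  case: ifP => [_|/negbT f2e]; first by right.
  suff fiT : f i = setT by rewrite fiT subsetT in nfk.
  apply/eqP; rewrite eqEcard subsetT cardsT card_ord; lia.
have c_inj : injective (c \o f).
  move=> i k /= /rainbowX; rewrite -fX !imset_f // => /(_ isT isT) fik.
  by apply/eqP; have := monof i k; rewrite fik lexx => /esym.
have : #|{: antichain 3}| <= size [:: 1; 2].
  rewrite cardE -(size_map (c \o f)).
  apply: uniq_leq_size; first by rewrite map_inj_uniq ?enum_uniq.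
  by move=> _ /mapP[i _ ->]; rewrite !inE /=; case: (c12 i) => ->.
by rewrite (card_ord 3).
Qed.

End Corollary.

Theorem corollary1p8 (d : Order.disp_t) (P : finPOrderType d)
    (P_gt0 : 0 < #|P|) :
  uniformly_induced_lubell_bounded P_gt0 ->
  ~ poset_iso P 'I_1 -> ~ poset_iso P 'I_2 ->
  strong_rainbow_ramsey_number P (antichain 3) (2 + 2 * e_star P_gt0).
Proof.
move=> bounded not1 not2; split; first exact: lubell_bounded_upper.
move=> m ramsey; rewrite leqNgt; apply/negP=> lt_m.
by apply: (lubell_bounded_lower not1 (rainbow_ramsey_propW _ ramsey)).
Qed.
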